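(* Let $R$ be a commutative ring with nonzero identity, $M_1,M_2$ $R$-modules and $N_1$ a proper submodule of $M_1$. Let $\psi_i:S(M_i)\to S(M_i)\cup\{\emptyset\}$ be functions for $i=1,2$ and let $\phi=\psi_1\times\psi_2$. Then the following conditions are equivalent. (1) $N=N_1\times M_2$ is a $\phi$-classical 1-absorbing prime submodule of $M=M_1\times M_2$. (2) $N_1$ is a $\psi_1$-classical 1-absorbing prime submodule of $M_1$, and for all nonunits $r,s,t\in R$ and $m_1\in M_1$, if $rstm_1\in\psi_1(N_1)$, $rsm_1\notin N_1$ and $tm_1\notin N_1$, then $rst\in(\psi_2(M_2):_R M_2)$.
   Context: All modules are unitary. $S(M)$ is the set of all submodules of $M$. Standing assumption: $\phi(N)\subseteq N$ for every submodule $N$ (and likewise for $\psi_1,\psi_2$). $\phi=\psi_1\times\psi_2$ means $\phi(L_1\times L_2)=\psi_1(L_1)\times\psi_2(L_2)$ for submodules $L_i$ of $M_i$ (a product with an empty factor is empty). $(A:_R X)=\{r\in R: rX\subseteq A\}$. A proper submodule $N$ of $M$ is $\phi$-classical 1-absorbing prime if whenever $a,b,c\in R$ are nonunits and $m\in M$ with $abcm\in N\setminus\phi(N)$, then $abm\in N$ or $cm\in N$. *)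

(* Defs.v *)
From HB Require Import structures.
From mathcomp Require Import all_boot all_algebra.
From mathcomp Require Import boolp classical_sets.
Set Implicit Arguments.
Unset Strict Implicit.
Unset Printing Implicit Defensive.
Import GRing.Theory.
Local Open Scope ring_scope.
Local Open Scope classical_set_scope.

(* Defined over a bare commutative ring, since GRing.unit would require the
   extra data of a decidable unit predicate and an inverse function. *)
Definition nonunit (R : comNzRingType) (r : R) : Prop :=
  ~ exists s : R, s * r = 1.

Record submodule (R : comNzRingType) (M : lmodType R) := Submodule {
  submodule_set :> set M;
  submodule_closed : GRing.submod_closed (mem submodule_set)
}.
Arguments Submodule {R M} submodule_set submodule_closed.

(* S(M) together with the empty set, which is represented by None. *)
Definition submodule0 (R : comNzRingType) (M : lmodType R) : Type :=
  option (submodule M).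

Definition submodule0_set (R : comNzRingType) (M : lmodType R)
    (L : submodule0 M) : set M :=
  if L is Some L' then submodule_set L' else set0.

Coercion submodule0_set : submodule0 >-> set.

Lemma full_submodule_closed (R : comNzRingType) (M : lmodType R) :
  GRing.submod_closed (mem [set: M]).
Proof. by split=> [|a u v _ _]; rewrite /= in_setT. Qed.

Definition full_submodule (R : comNzRingType) (M : lmodType R) : submodule M :=
  Submodule [set: M] (full_submodule_closed M).

Lemma prod_submodule_closed (R : comNzRingType) (M1 M2 : lmodType R)
    (L1 : submodule M1) (L2 : submodule M2) :
  GRing.submod_closed (mem ((L1 : set M1) `*` (L2 : set M2))).
Proof.
case: L1 L2 => [A1 [A10 A1c]] [A2 [A20 A2c]]; split=> [|a u v] /=.
  by apply: mem_set; split; apply: set_mem.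
move=> /set_mem[u1 u2] /set_mem[v1 v2]; apply: mem_set; split; apply: set_mem.
- by apply: A1c; apply: mem_set.
- by apply: A2c; apply: mem_set.
Qed.

Definition prod_submodule (R : comNzRingType) (M1 M2 : lmodType R)
    (L1 : submodule M1) (L2 : submodule M2) : submodule (M1 * M2)%type :=
  Submodule ((L1 : set M1) `*` (L2 : set M2)) (prod_submodule_closed L1 L2).

Definition contracting (R : comNzRingType) (M : lmodType R)
    (phi : submodule M -> submodule0 M) : Prop :=
  forall N : submodule M, (phi N : set M) `<=` (N : set M).

(* Constrains phi only on submodules of the form L1 x L2, the only ones on
   which psi1 x psi2 is defined.  The equation is one of sets, so that
   phi (L1 x L2) is empty as soon as psi1 L1 or psi2 L2 is. *)
Definition is_prod_fun (R : comNzRingType) (M1 M2 : lmodType R)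
    (phi : submodule (M1 * M2)%type -> submodule0 (M1 * M2)%type)
    (psi1 : submodule M1 -> submodule0 M1)
    (psi2 : submodule M2 -> submodule0 M2) : Prop :=
  forall (L1 : submodule M1) (L2 : submodule M2),
    (phi (prod_submodule L1 L2) : set (M1 * M2)%type) =
    (psi1 L1 : set M1) `*` (psi2 L2 : set M2).

Definition residual (R : comNzRingType) (M : lmodType R) (A X : set M) : set R :=
  [set r : R | [set r *: x | x in X] `<=` A].

Definition classical_1abs_prime (R : comNzRingType) (M : lmodType R)
    (phi : submodule M -> submodule0 M) (N : submodule M) : Prop :=
  (N : set M) `<` [set: M] /\
  forall (a b c : R) (m : M), nonunit a -> nonunit b -> nonunit c ->
    ((N : set M) `\` (phi N : set M)) ((a * b * c) *: m) ->
    (N : set M) ((a * b) *: m) \/ (N : set M) (c *: m).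

(* Main.v *)
Require Import Defs.
From HB Require Import structures.
From mathcomp Require Import all_boot all_algebra.
From mathcomp Require Import boolp classical_sets.
Local Open Scope ring_scope.
Local Open Scope classical_set_scope.

(** Since the second factor of [N] is all of [M2], membership in [N] is decided by the first
    coordinate. By [hprod], [phi N] is [psi1 N1] times [psi2 M2], so a pair in [N] avoids [phi N]
    exactly when its first coordinate avoids [psi1 N1] or its second avoids [psi2 M2]. The first way
    out gives the primeness of [N1], the second the residual condition. *)

Theorem theorem16 (R : comNzRingType) (M1 M2 : lmodType R)
    (N1 : submodule M1) (hN1 : (N1 : set M1) `<` [set: M1])
    (psi1 : submodule M1 -> submodule0 M1)
    (psi2 : submodule M2 -> submodule0 M2)
    (phi : submodule (M1 * M2)%type -> submodule0 (M1 * M2)%type)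
    (hpsi1 : contracting psi1) (hpsi2 : contracting psi2)
    (hphi : contracting phi)
    (hprod : is_prod_fun phi psi1 psi2) :
  classical_1abs_prime phi (prod_submodule N1 (full_submodule M2)) <->
  (classical_1abs_prime psi1 N1 /\
   forall (r s t : R) (m1 : M1), nonunit r -> nonunit s -> nonunit t ->
     (psi1 N1 : set M1) ((r * s * t) *: m1) ->
     ~ (N1 : set M1) ((r * s) *: m1) ->
     ~ (N1 : set M1) (t *: m1) ->
     residual (psi2 (full_submodule M2) : set M2) [set: M2] (r * s * t)).
Proof.
split=> [[_ N_prime] | [[_ N1_prime] psi2_residual]].
- split.
    split=> // a b c m na nb nc [Nabcm psi1'abcm].
    (* Any second coordinate would do: the first alone keeps the pair out of [phi N]. *)
    case: (N_prime a b c (m, 0) na nb nc); [|by case; left|by case; right].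
    by split; [split | rewrite hprod; case].
  move=> r s t m1 nr ns nt psi1rstm N1'rsm N1'tm _ [m2 _ <-].
  apply: contrapT => psi2'rstm.
  (* Here [m2] keeps the pair out of [phi N], while [hpsi1] puts it in [N]. *)
  case: (N_prime r s t (m1, m2) nr ns nt); [|by case|by case].
  by split; [split=> //; exact: hpsi1 | rewrite hprod; case].
- split.
    case: hN1 => _ N1'; split=> // TN; apply: N1' => m _.
    by case: (TN (m, 0) I).
  move=> a b c [m1 m2] na nb nc [[/= N1abcm _]]; rewrite hprod => phi'abcm.
  (* Outside [psi1 N1], primeness of [N1] applies. Inside, if both conclusions failed, the residual
     condition would put the second coordinate in [psi2 M2], hence the pair in [phi N]. *)
  have [psi1abcm|psi1'abcm] :=
    EM ((psi1 N1 : set M1) ((a * b * c) *: m1)); last first.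
    by case: (N1_prime a b c m1 na nb nc) => // ?; [left | right].
  have [|N1'abm] := EM ((N1 : set M1) ((a * b) *: m1)); first by left.
  have [|N1'cm] := EM ((N1 : set M1) (c *: m1)); first by right.
  case: phi'abcm; split=> //=.
  apply: (psi2_residual a b c m1 na nb nc psi1abcm N1'abm N1'cm).
  by exists m2.
Qed.
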